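(* Let $\mathbb{k}$ be an algebraically closed field with $\mathrm{char}(\mathbb{k})\neq 2$, and let $\mathfrak{g}=\mathfrak{sl}(1|1)$ over $\mathbb{k}$, with $\hat H$ and $L_{(\mathfrak{h},\phi)}$ as defined in the context. The line modules over $\hat H$ that correspond to the lines in $\mathbb{P}^3$ that are not contained in the plane $\mathcal{V}(t)$ and that meet the line $\mathcal{V}(h,t)$ are precisely (up to isomorphism) the $\hat H$-modules $L_{(\mathfrak{h},\phi)}$, for all $2$-dimensional subalgebras $\mathfrak{h}$ of $\mathfrak{g}$ and all linear functionals $\phi\in\mathfrak{h}^*$.
   Context: Lie superalgebra: $\mathfrak{g}=\mathfrak{sl}(1|1)$ is the set of $2\times 2$ matrices $\begin{bmatrix} a&b\\c&d\end{bmatrix}$ over $\mathbb{k}$ with $a-d=0$. It has basis $e=\begin{bmatrix}0&1\\0&0\end{bmatrix}$, $f=\begin{bmatrix}0&0\\1&0\end{bmatrix}$, $h=\begin{bmatrix}1&0\\0&1\end{bmatrix}$, is $\mathbb{Z}_2$-graded with $\mathfrak{g}_{\overline 0}=\mathbb{k}h$, $\mathfrak{g}_{\overline 1}=\mathbb{k}e\oplus\mathbb{k}f$, and has bilinear superbracket given by $[X,Y]=XY-(-1)^{|X||Y|}YX$ for homogeneous $X,Y$, so $[e,f]=[f,e]=h$ and all other brackets of basis elements are $0$. A subalgebra of $\mathfrak{g}$ means any subspace closed under the superbracket (not required to be graded). The $2$-dimensional subalgebras are exactly the subspaces $\mathfrak{h}=\mathbb{k}h\oplus\mathbb{k}(\alpha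 e+\beta f)$ with $(\alpha,\beta)\in\mathbb{P}^1$. Algebra: $\hat H=\mathbb{k}\langle e,f,h,t\rangle/\langle ef+fe-ht,\ he-eh,\ hf-fh,\ et-te,\ ft-tf,\ ht-th\rangle$, $\mathbb{Z}$-graded with $e,f,h,t$ in degree $1$; $\hat H_1$ denotes its degree-one part. Modules: modules are left modules. A line module over $\hat H$ is a graded cyclic $\hat H$-module with Hilbert series $1/(1-x)^2$. Lines: $\mathbb{P}^3$ is identified with $\mathbb{P}((\mathbb{k}e\oplus\mathbb{k}f\oplus\mathbb{k}h\oplus\mathbb{k}t)^* )$, so elements of $\hat H_1$ are linear forms on $\mathbb{P}^3$; $\mathcal{V}(\cdot)$ denotes the zero locus in $\mathbb{P}^3$. A line $\mathcal{V}(u,v)$, with $u,v\in\hat H_1$ linearly independent, corresponds to a line module if $\hat H/(\hat Hu+\hat Hv)$ is a line module, and then that module is the line module corresponding to $\mathcal{V}(u,v)$. For $\mathfrak{h}=\mathbb{k}h\oplus\mathbb{k}(\alpha e+\beta f)$ with $(\alpha,\beta)\in\mathbb{P}^1$ and $\phi\in\mathfrak{h}^*$, define $$L_{(\mathfrak{h},\phi)}=\frac{\hat H}{\hat H(h-\phi(h)t)+\hat H(\alpha e+\beta f-\phi(\alpha e+\beta f)t)}.$$ *)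

(* Defs.v *)
From HB Require Import structures.
From mathcomp Require Import all_boot all_order all_algebra.
From mathcomp Require Import boolp.
From mathcomp Require Import ring.
From mathcomp.multinomials Require Import monalg.

Set Implicit Arguments.
Unset Strict Implicit.
Unset Printing Implicit Defensive.

Import GRing.Theory.
Local Open Scope ring_scope.
Local Open Scope quotient_scope.

Section Sl11.
Variable k : fieldType.

Definition sl11 : {pred 'M[k]_2} := [pred X : 'M[k]_2 | X 0 0 - X 1 1 == 0].

Definition sl_e : 'M[k]_2 := delta_mx 0 1.
Definition sl_f : 'M[k]_2 := delta_mx 1 0.
Definition sl_h : 'M[k]_2 := 1%:M.

(* Homogeneous component of parity [b] ([false]: even, diagonal;
   [true]: odd, antidiagonal). *)
Definition hcomp (b : bool) (X : 'M[k]_2) : 'M[k]_2 :=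
  \matrix_(i, j) (if (i != j) == b then X i j else 0).

(* The bilinear extension of [X, Y] = XY - (-1)^(|X||Y|) YX. *)
Definition sbracket (X Y : 'M[k]_2) : 'M[k]_2 :=
  \sum_(a : bool) \sum_(b : bool)
    (hcomp a X *m hcomp b Y - (-1) ^+ (a && b) *: (hcomp b Y *m hcomp a X)).

Definition is_subalgebra (V : {vspace 'M[k]_2}) : Prop :=
  {subset V <= sl11} /\
  (forall X Y, X \in V -> Y \in V -> sbracket X Y \in V).

(* (alpha, beta) are homogeneous coordinates of a point of P^1. *)
Definition is_subalgebra_at (V : {vspace 'M[k]_2}) (alpha beta : k) : Prop :=
  (alpha, beta) != (0, 0) /\
  V = (<[sl_h]> + <[alpha *: sl_e + beta *: sl_f]>)%VS.

Lemma sbracketE (X Y : 'M[k]_2) : X \in sl11 -> Y \in sl11 ->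
  sbracket X Y = (X 0 1 * Y 1 0 + X 1 0 * Y 0 1) *: sl_h.
Proof.
rewrite !inE !subr_eq0 => /eqP hX /eqP hY.
have E (i : 'I_2) : (i == 0) || (i == 1) by case: i => [[|[|]]].
have E01 : ((0 : 'I_2) == 1) = false by [].
have E10 : ((1 : 'I_2) == 0) = false by [].
have L : lift (0 : 'I_2) (0 : 'I_1) = 1 by apply: val_inj.
rewrite /sbracket !big_bool /= expr1 !expr0.
apply/matrixP => i j; rewrite !mxE !big_ord_recl !big_ord0 !mxE /= !L.
by case/orP: (E i) => /eqP->; case/orP: (E j) => /eqP->;
  rewrite ?eqxx ?E01 ?E10 /= ?hX ?hY; ring.
Qed.

Lemma sl11_decomp (X : 'M[k]_2) : X \in sl11 ->
  X = X 0 0 *: sl_h + (X 0 1 *: sl_e + X 1 0 *: sl_f).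
Proof.
rewrite !inE !subr_eq0 => /eqP hX.
have E (i : 'I_2) : (i == 0) || (i == 1) by case: i => [[|[|]]].
have E01 : ((0 : 'I_2) == 1) = false by [].
have E10 : ((1 : 'I_2) == 0) = false by [].
apply/matrixP => i j; rewrite !mxE.
by case/orP: (E i) => /eqP->; case/orP: (E j) => /eqP->;
  rewrite ?eqxx ?E01 ?E10 /= ?hX; ring.
Qed.

Lemma sl11_coord (c a b : k) (X := c *: sl_h + (a *: sl_e + b *: sl_f)) :
  [/\ X \in sl11, X 0 0 = c, X 0 1 = a & X 1 0 = b].
Proof.
have E01 : ((0 : 'I_2) == 1) = false by [].
have E10 : ((1 : 'I_2) == 0) = false by [].
rewrite /X !inE !mxE ?eqxx ?E01 ?E10 /=.
by split; [apply/eqP; ring | ring | ring | ring].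
Qed.

Lemma subalgebra_classification (V : {vspace 'M[k]_2}) :
  is_subalgebra V /\ \dim V = 2%N <->
  exists alpha beta : k, is_subalgebra_at V alpha beta.
Proof.
split=> [[[sV bV] dV]|[a [b [ab0 ->]]]].
- have hV : sl_h \in V.
    suff [Z [ZV Z0 Z01 Z10]] : exists Z : 'M[k]_2,
        [/\ Z \in V, Z != 0, Z 0 1 = 0 & Z 1 0 = 0].
      have ZE := sl11_decomp (sV _ ZV).
      rewrite Z01 Z10 !scale0r !addr0 in ZE.
      have c0 : Z 0 0 != 0 by apply: contraNneq Z0 => c0; rewrite ZE c0 scale0r.
      by rewrite -[sl_h](scalerK c0) -ZE memvZ.
    have XV := memv_pick V; set X := vpick V in XV.
    have X0 : X != 0 by rewrite vpick0 -dimv_eq0 dV.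
    have [Y YV YX] : exists2 Y, Y \in V & Y \notin <[X]>%VS.
      by apply/subvPn/negP => /dimvS; rewrite dim_vline X0 dV.
    have [D0|D0] := eqVneq (X 0 1 * Y 1 0 - X 1 0 * Y 0 1) 0; last first.
      exists sl_h; set D := _ - _ in D0.
      pose X' := D^-1 *: (Y 1 0 *: X - X 1 0 *: Y).
      pose Y' := D^-1 *: (X 0 1 *: Y - Y 0 1 *: X).
      have X'V : X' \in V by rewrite memvZ ?memvB ?memvZ.
      have Y'V : Y' \in V by rewrite memvZ ?memvB ?memvZ.
      have := bV _ _ X'V Y'V; rewrite sbracketE ?sV //.
      suff -> : X' 0 1 * Y' 1 0 + X' 1 0 * Y' 0 1 = 1.
        rewrite scale1r => hV; split=> //; first by rewrite matrix_nonzero1.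
          by rewrite !mxE.
        by rewrite !mxE.
      by rewrite !mxE /D; field.
    have [X10|X10] := eqVneq (X 1 0) 0; last first.
      exists (Y 1 0 *: X - X 1 0 *: Y); split.
      + by rewrite memvB ?memvZ.
      + apply: contraNneq YX => /eqP; rewrite subr_eq0 => /eqP E.
        by rewrite -[Y](scalerK X10) -E !memvZ ?memv_line.
      + by rewrite !mxE -D0; ring.
      + by rewrite !mxE; ring.
    have [X01|X01] := eqVneq (X 0 1) 0; first by exists X.
    exists (Y 0 1 *: X - X 0 1 *: Y); split.
    + by rewrite memvB ?memvZ.
    + apply: contraNneq YX => /eqP; rewrite subr_eq0 => /eqP E.
      by rewrite -[Y](scalerK X01) -E !memvZ ?memv_line.
    + by rewrite !mxE; ring.
    + by rewrite !mxE -[RHS]oppr0 -D0; ring.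
  have h0 : sl_h != 0 by exact: matrix_nonzero1.
  have [Y YV Yh] : exists2 Y, Y \in V & Y \notin <[sl_h]>%VS.
    by apply/subvPn/negP => /dimvS; rewrite dim_vline h0 dV.
  have YE := sl11_decomp (sV _ YV).
  exists (Y 0 1), (Y 1 0); set W := _ *: sl_e + _ in YE *.
  have WV : W \in V.
    by rewrite -[W](addKr (Y 0 0 *: sl_h)) -YE memvD ?memvN ?memvZ.
  have Wh : W \notin <[sl_h]>%VS.
    by apply: contra Yh => Wh; rewrite YE memvD ?memvZ ?memv_line.
  split.
    apply: contraNneq Wh => -[E1 E2].
    by rewrite /W E1 E2 !scale0r addr0 mem0v.
  apply/eqP; rewrite eq_sym eqEdim subv_add -!memvE hV WV /= dV.
  have : free [:: W; sl_h] by rewrite free_cons span_seq1 Wh seq1_free h0.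
  by rewrite /free span_cons span_seq1 addvC => /eqP->.
- set W := a *: sl_e + b *: sl_f.
  have mem X : X \in (<[sl_h]> + <[W]>)%VS ->
      exists c d, X = c *: sl_h + ((d * a) *: sl_e + (d * b) *: sl_f).
    case/memv_addP => u /vlineP[c ->] [v /vlineP[d ->] ->].
    by exists c, d; rewrite scalerDr !scalerA.
  have sV : {subset (<[sl_h]> + <[W]>)%VS <= sl11}.
    by move=> X /mem[c [d ->]]; case: (sl11_coord c (d * a) (d * b)).
  split.
    split=> // X Y XV YV; rewrite sbracketE ?sV //.
    by rewrite memvZ // memvE addvSl.
  have h0 : sl_h != 0 by exact: matrix_nonzero1.
  have : free [:: W; sl_h].
    rewrite free_cons span_seq1 seq1_free h0 andbT.
    apply: contra ab0 => /vlineP[c E].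
    have [_ _ W01 W10] := sl11_coord 0 a b.
    rewrite scale0r add0r -/W E in W01 W10.
    by rewrite -W01 -W10 !mxE /= mulr0.
  by rewrite /free span_cons span_seq1 addvC => /eqP->.
Qed.
End Sl11.

Section Hhat.
Variable k : fieldType.

Local Notation freealg := {malg k[{fmonom 'I_4}]}.

Lemma freealg_scaleAr (c : k) (x y : freealg) : c *: (x * y) = x * (c *: y).
Proof.
have cC : c%:MP * x = x * c%:MP.
  rewrite mul_malgC malgM_def malgZ_def fgmulgU.
  by apply: eq_bigr => w _; rewrite mulm1 mulrC.
rewrite -!mul_malgC mulrA cC; exact: esym (mulrA _ _ _).
Qed.

(* The free generators e, f, h, t, numbered 0, 1, 2, 3. *)
Definition fgen (i : 'I_4) : freealg := << fmu i >>.

Definition hrels : seq freealg :=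
  let e := fgen 0 in let f := fgen 1 in let h := fgen 2%:R in
  let t := fgen 3%:R in
  [:: e * f + f * e - h * t; h * e - e * h; h * f - f * h;
      e * t - t * e; f * t - t * f; h * t - t * h].

(* The two-sided ideal generated by [hrels]: finite sums of a * r * b. *)
Definition hideal : {pred freealg} := fun x =>
  `[< exists2 s : seq (freealg * freealg * freealg),
        all (fun p => p.1.2 \in hrels) s &
        x = \sum_(p <- s) p.1.1 * p.1.2 * p.2 >].

Lemma hidealP x : reflect (exists2 s : seq (freealg * freealg * freealg),
        all (fun p => p.1.2 \in hrels) s &
        x = \sum_(p <- s) p.1.1 * p.1.2 * p.2) (x \in hideal).
Proof. exact: asboolP. Qed.

Lemma hidealMl a x : x \in hideal -> a * x \in hideal.
Proof.
case/hidealP=> s hs ->; apply/hidealP.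
exists [seq (a * p.1.1, p.1.2, p.2) | p <- s]; first by rewrite all_map.
by rewrite big_map mulr_sumr; apply: eq_bigr => p _ /=; rewrite 2!mulrA.
Qed.

Lemma hidealMr a x : x \in hideal -> x * a \in hideal.
Proof.
case/hidealP=> s hs ->; apply/hidealP.
exists [seq (p.1.1, p.1.2, p.2 * a) | p <- s]; first by rewrite all_map.
rewrite big_map mulr_suml; apply: eq_bigr => p _; exact: esym (mulrA _ _ _).
Qed.

Lemma hideal_zmod_closed : zmod_closed hideal.
Proof.
split=> [|x y]; first by apply/hidealP; exists [::]; rewrite ?big_nil.
move=> xI; rewrite -mulN1r => /(hidealMl (-1)) /hidealP[s' hs' ->].
case/hidealP: xI => s hs ->; apply/hidealP; exists (s ++ s').
  by rewrite all_cat hs.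
by rewrite big_cat.
Qed.
HB.instance Definition _ :=
  GRing.isZmodClosed.Build freealg hideal hideal_zmod_closed.

Lemma hideal_mcoeff1 x : x \in hideal -> mcoeff (@mone {fmonom 'I_4}) x = 0.
Proof.
have g0 i : mcoeff (@mone {fmonom 'I_4}) (fgen i) = 0.
  by rewrite mcoeffU1 fm1_eq1.
have mcoeff1g_mul (x1 x2 : freealg) : (x1 * x2)@_mone = x1@_mone * x2@_mone.
  exact: (rmorphM (@mcoeff {fmonom 'I_4} k mone)).
have r0 r : r \in hrels -> mcoeff (@mone {fmonom 'I_4}) r = 0.
  rewrite /hrels; move: (fgen 0) (fgen 1) (fgen 2%:R) (fgen 3%:R)
    (g0 0) (g0 1) (g0 2%:R) (g0 3%:R) => e f h t e0 f0 h0 t0.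
  rewrite !in_cons in_nil.
  have m0 (a b : freealg) : a@_mone = 0 -> (a * b)@_mone = 0.
    by move=> a0; rewrite mcoeff1g_mul a0 mul0r.
  have mD (a b : freealg) : a@_mone = 0 -> b@_mone = 0 -> (a + b)@_mone = 0.
    by move=> a0 b0; rewrite mcoeffD a0 b0 addr0.
  have mB (a b : freealg) : a@_mone = 0 -> b@_mone = 0 -> (a - b)@_mone = 0.
    by move=> a0 b0; rewrite mcoeffB a0 b0 subr0.
  case/or4P=> [||| /or4P[|||//]] /eqP ->; apply: (mB); try exact: m0.
  by apply: (mD); exact: m0.
case/hidealP=> s /allP hs ->; rewrite raddf_sum big_seq big1 //= => p /hs /r0 p0.
by rewrite !mcoeff1g_mul p0 mulr0 mul0r.
Qed.

Definition Hhat := Quotient.quot hideal.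
HB.instance Definition _ := GRing.Zmodule.on Hhat.
HB.instance Definition _ := EqQuotient.on Hhat.

Lemma hpiE (x y : freealg) : (\pi_Hhat x == \pi_Hhat y) = (x - y \in hideal).
Proof. by rewrite Quotient.idealrBE. Qed.

Lemma repr_piB (x : freealg) : x - repr (\pi_Hhat x) \in hideal.
Proof. by rewrite -hpiE reprK. Qed.

Let hpiD (x y : freealg) : \pi_Hhat (x + y) = \pi_Hhat x + \pi_Hhat y.
Proof. exact: (raddfD (\pi_(Quotient.quot hideal))). Qed.

Definition Hone : Hhat := \pi_Hhat 1.
Definition Hmul : Hhat -> Hhat -> Hhat := lift_op2 Hhat *%R.
Definition Hscale (c : k) : Hhat -> Hhat := lift_op1 Hhat ( *:%R c).

Lemma HmulE x y : Hmul (\pi_Hhat x) (\pi_Hhat y) = \pi_Hhat (x * y).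
Proof.
unlock Hmul; apply/eqP; rewrite hpiE -opprB rpredN.
have -> : x * y - repr (\pi_Hhat x) * repr (\pi_Hhat y) =
    (x - repr (\pi_Hhat x)) * y + repr (\pi_Hhat x) * (y - repr (\pi_Hhat y)).
  by rewrite mulrBl mulrBr addrA subrK.
by apply: rpredD; [apply: hidealMr | apply: hidealMl]; exact: repr_piB.
Qed.

Lemma HscaleE c x : Hscale c (\pi_Hhat x) = \pi_Hhat (c *: x).
Proof.
unlock Hscale; apply/eqP; rewrite hpiE -opprB rpredN -scalerBr -mulr_algl.
by rewrite hidealMl ?repr_piB.
Qed.

Lemma HmulA : associative Hmul.
Proof.
elim/quotW=> x; elim/quotW=> y; elim/quotW=> z.
by rewrite !HmulE; apply: (congr1 \pi_Hhat); exact: mulrA.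
Qed.
Lemma Hmul1 : left_id Hone Hmul.
Proof.
by elim/quotW=> x; rewrite HmulE; apply: (congr1 \pi_Hhat); exact: mul1r.
Qed.
Lemma H1mul : right_id Hone Hmul.
Proof.
by elim/quotW=> x; rewrite HmulE; apply: (congr1 \pi_Hhat); exact: mulr1.
Qed.
Lemma HmulDl : left_distributive Hmul +%R.
Proof.
elim/quotW=> x; elim/quotW=> y; elim/quotW=> z.
by rewrite -hpiD !HmulE -hpiD; apply: (congr1 \pi_Hhat); exact: mulrDl.
Qed.
Lemma HmulDr : right_distributive Hmul +%R.
Proof.
elim/quotW=> x; elim/quotW=> y; elim/quotW=> z.
by rewrite -hpiD !HmulE -hpiD; apply: (congr1 \pi_Hhat); exact: mulrDr.
Qed.
Lemma Hone_neq0 : Hone != 0.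
Proof.
have -> : 0 = \pi_Hhat 0 :> Hhat by exact: esym (raddf0 (\pi_(Quotient.quot hideal))).
rewrite hpiE subr0; apply/negP => /hideal_mcoeff1/eqP.
by rewrite mcoeff1 eqxx oner_eq0.
Qed.
HB.instance Definition _ := GRing.Zmodule_isNzRing.Build Hhat
  HmulA Hmul1 H1mul HmulDl HmulDr Hone_neq0.

Lemma HscaleA a b x : Hscale a (Hscale b x) = Hscale (a * b) x.
Proof. by elim/quotW: x => x; rewrite !HscaleE scalerA. Qed.
Lemma Hscale1 : left_id 1 Hscale.
Proof. by elim/quotW=> x; rewrite HscaleE scale1r. Qed.
Lemma HscaleDr : right_distributive Hscale +%R.
Proof.
move=> c; elim/quotW=> x; elim/quotW=> y.
by rewrite -hpiD !HscaleE scalerDr hpiD.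
Qed.
Lemma HscaleDl x : {morph Hscale^~ x : a b / a + b}.
Proof. by move=> a b; elim/quotW: x => x; rewrite !HscaleE scalerDl hpiD. Qed.
HB.instance Definition _ := GRing.Zmodule_isLmodule.Build k Hhat
  HscaleA Hscale1 HscaleDr HscaleDl.

Lemma hpiM (x y : freealg) : \pi_Hhat x * \pi_Hhat y = \pi_Hhat (x * y).
Proof. exact: HmulE. Qed.

Lemma hpiZ c (x : freealg) : c *: \pi_Hhat x = \pi_Hhat (c *: x).
Proof. exact: HscaleE. Qed.

Lemma HscaleAl c (x y : Hhat) : c *: (x * y) = (c *: x) * y.
Proof.
elim/quotW: x => x; elim/quotW: y => y.
rewrite (hpiM x y) (hpiZ c (x * y)) (hpiZ c x) (hpiM (c *: x) y).
by apply: (congr1 \pi_Hhat); exact: scalerAl.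
Qed.
HB.instance Definition _ := GRing.Lmodule_isLalgebra.Build k Hhat HscaleAl.

Lemma HscaleAr c (x y : Hhat) : c *: (x * y) = x * (c *: y).
Proof.
elim/quotW: x => x; elim/quotW: y => y.
rewrite (hpiM x y) (hpiZ c (x * y)) (hpiZ c y) (hpiM x (c *: y)).
by apply: (congr1 \pi_Hhat); exact: freealg_scaleAr.
Qed.
HB.instance Definition _ := GRing.Lalgebra_isAlgebra.Build k Hhat HscaleAr.

Definition hgen (i : 'I_4) : Hhat := \pi_Hhat (fgen i).

(* The homogeneous elements of degree n. *)
Definition Hdeg (n : int) (x : Hhat) : Prop :=
  exists2 a : freealg,
    (forall w, a@_w != 0 -> (fdeg w)%:Z = n) & x = \pi_Hhat a.

(* [comp] is a Z-grading of the left module M. The [comp n] are k-subspaces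
   because k lies in [Hdeg 0]. *)
Definition is_grading (M : lmodType Hhat) (comp : int -> M -> Prop) : Prop :=
  [/\ forall n, comp n 0 /\ (forall x y, comp n x -> comp n y -> comp n (x + y)),
      forall i j a x, Hdeg i a -> comp j x -> comp (i + j) (a *: x),
      forall x, exists (s : seq int) (y : int -> M),
        (forall n, comp n (y n)) /\ x = \sum_(n <- s) y n &
      forall (s : seq int) (y : int -> M), uniq s ->
        (forall n, comp n (y n)) -> \sum_(n <- s) y n = 0 ->
        forall n, n \in s -> y n = 0].

(* The k-subspace S of M has dimension d; c in k acts as c%:A in Hhat. *)
Definition has_kdim (M : lmodType Hhat) (S : M -> Prop) (d : nat) : Prop :=
  exists b : 'I_d -> M,
    (forall c : 'I_d -> k, \sum_i (c i)%:A *: b i = 0 -> forall i, c i = 0) /\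
    (forall x, S x <-> exists c : 'I_d -> k, x = \sum_i (c i)%:A *: b i).

(* The power series \sum_n (d n) x^n equals 1/(1 - x)^2. *)
Definition is_line_series (d : nat -> nat) : Prop :=
  forall n, \sum_(i < n.+1) (d i)%:Z * ((1 - 'X) ^+ 2 : {poly int})`_(n - i)
            = (n == 0%N)%:R.

Definition is_line_module (M : lmodType Hhat) (comp : int -> M -> Prop) : Prop :=
  [/\ is_grading comp,
      exists n (x : M), comp n x /\ (forall y : M, exists a : Hhat, y = a *: x),
      forall n : nat, has_kdim (comp (Negz n)) 0 &
      exists d : nat -> nat,
        (forall n : nat, has_kdim (comp n%:Z) (d n)) /\ is_line_series d].

Definition graded_iso (M : lmodType Hhat) (compM : int -> M -> Prop)
    (N : lmodType Hhat) (compN : int -> N -> Prop) : Prop :=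
  exists2 phi : {linear M -> N}, bijective phi &
    forall n x, compM n x <-> compN n (phi x).

Section Quotient2.
Variables u v : Hhat.

Definition lideal2 : {pred Hhat} := fun x =>
  `[< exists a b : Hhat, x = a * u + b * v >].

Lemma lideal2Ml a x : x \in lideal2 -> a * x \in lideal2.
Proof.
case/asboolP=> b [c ->]; apply/asboolP; exists (a * b), (a * c).
by rewrite mulrDr !mulrA.
Qed.

Lemma lideal2_zmod_closed : zmod_closed lideal2.
Proof.
split=> [|_ _ /asboolP[a [b ->]] /asboolP[c [d ->]]]; apply/asboolP.
  by exists 0, 0; rewrite !mul0r addr0.
by exists (a - c), (b - d); rewrite !mulrBl opprD addrACA.
Qed.
HB.instance Definition _ :=
  GRing.isZmodClosed.Build Hhat lideal2 lideal2_zmod_closed.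

Definition Hquo2 := Quotient.quot lideal2.
HB.instance Definition _ := GRing.Zmodule.on Hquo2.
HB.instance Definition _ := EqQuotient.on Hquo2.

Definition qscale (a : Hhat) : Hquo2 -> Hquo2 := lift_op1 Hquo2 ( *%R a).

Lemma qscaleE a x : qscale a (\pi_Hquo2 x) = \pi_Hquo2 (a * x).
Proof.
unlock qscale; apply/eqP; rewrite /Hquo2 -Quotient.idealrBE -mulrBr lideal2Ml //.
by rewrite Quotient.idealrBE reprK.
Qed.

Let qpiD x y : \pi_Hquo2 (x + y) = \pi_Hquo2 x + \pi_Hquo2 y.
Proof. exact: (raddfD (\pi_(Quotient.quot lideal2))). Qed.

Lemma qscaleA a b x : qscale a (qscale b x) = qscale (a * b) x.
Proof. by rewrite -[x]reprK !qscaleE mulrA. Qed.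
Lemma qscale1 : left_id 1 qscale.
Proof. by move=> x; rewrite -[x]reprK qscaleE mul1r. Qed.
Lemma qscaleDr : right_distributive qscale +%R.
Proof.
move=> a x y; rewrite -[x]reprK -[y]reprK.
by rewrite -qpiD !qscaleE mulrDr qpiD.
Qed.
Lemma qscaleDl x : {morph qscale^~ x : a b / a + b}.
Proof. by move=> a b; rewrite -[x]reprK !qscaleE mulrDl qpiD. Qed.
HB.instance Definition _ := GRing.Zmodule_isLmodule.Build Hhat Hquo2
  qscaleA qscale1 qscaleDr qscaleDl.

(* The grading induced by that of Hhat. *)
Definition Hquo2_deg (n : int) (x : Hquo2) : Prop :=
  exists2 a : Hhat, Hdeg n a & x = \pi_Hquo2 a.

End Quotient2.

(* ke + kf + kh + kt is identified with row vectors, and its dual with column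
   vectors. *)
Definition hlin (w : 'rV[k]_4) : Hhat := \sum_i w 0 i *: hgen i.

Definition form_h : 'rV[k]_4 := delta_mx 0 2%:R.
Definition form_t : 'rV[k]_4 := delta_mx 0 3%:R.

(* The column vector p <> 0 represents a point of P^3 in the zero locus of the
   linear forms w in ws. *)
Definition zero_locus (ws : seq 'rV[k]_4) (p : 'cV[k]_4) : Prop :=
  p != 0 /\ (forall w, w \in ws -> w *m p = 0).

Definition locus_sub (ws ws' : seq 'rV[k]_4) : Prop :=
  forall p, zero_locus ws p -> zero_locus ws' p.

Definition locus_meet (ws ws' : seq 'rV[k]_4) : Prop :=
  exists p, zero_locus ws p /\ zero_locus ws' p.

(* The line module corresponding to the line V(u, v), when
   [corresponds_to_line_module u v]. *)
Definition line_quo (u v : 'rV[k]_4) : lmodType Hhat := Hquo2 (hlin u) (hlin v).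
Definition line_quo_deg (u v : 'rV[k]_4) : int -> line_quo u v -> Prop :=
  @Hquo2_deg (hlin u) (hlin v).

Definition corresponds_to_line_module (u v : 'rV[k]_4) : Prop :=
  free [:: u; v] /\ is_line_module (@line_quo_deg u v).

Section LModule.
Variables (V : {vspace 'M[k]_2}) (phi : 'Hom(subvs_of V, k^o)) (alpha beta : k).

Let phiV (X : 'M[k]_2) : k := phi (vsproj V X).

Definition L_h : Hhat := hgen 2%:R - phiV (sl_h k) *: hgen 3%:R.
Definition L_ef : Hhat :=
  alpha *: hgen 0 + beta *: hgen 1
  - phiV (alpha *: sl_e k + beta *: sl_f k) *: hgen 3%:R.

Definition Lmod : lmodType Hhat := Hquo2 L_h L_ef.
Definition Lmod_deg : int -> Lmod -> Prop := @Hquo2_deg L_h L_ef.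
End LModule.

End Hhat.

(* Main.v *)
From HB Require Import structures.
Require Import Defs.
From mathcomp Require Import all_boot all_algebra.
From mathcomp Require Import boolp finmap ring zify.
From mathcomp.multinomials Require Import monalg.

(** Both halves rest on a description of the left ideal attached to a line.

    Suppose the line V(u, v) meets V(h, t) at p and leaves the plane V(t) at r.
    A linear form vanishing at p and r is a combination of h - lambda t and
    w - mu t, where w = alpha e + beta f is the combination of e and f
    vanishing at p (unique up to scale), and lambda, mu are the values of h and
    w at r when r is normalised by t = 1.  So u and v span the same plane of
    forms as those two, hence generate the same left ideal, and the quotient by
    it is L_(h, phi) for phi the evaluation at r ([form_through_points], [line_ideal], [line_is_L]).

    For the converse, L_(h, phi) is the quotient attached to the line
    V(h - lambda t, w - mu t), which visibly meets V(h, t) and leaves V(t); what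
    has to be proved is that this quotient is a line module.  Scaling w, it is
    p + beta q where p, q now denote e, f in one of the two orders.  The
    monomials q^i t^(n-i), 0 <= i <= n, form a basis of the degree n part:

    - they span, because w q = - q w + h t + 2 beta q^2 and the centrality of h
      and t allow w and h to be pushed to the right of any monomial in q and t,
      where the ideal turns them into multiples of t ([NormalForm]);

    - they are independent, because k[q, t] carries the module structure
      predicted by these rules: q^2 is central in the algebra, so the action
      should be linear over k[s, t] with s = q^2, where k[q, t] is free of
      rank 2, and the predicted action on the basis 1, q is given by explicit
      2 x 2 matrices over k[s, t] that do satisfy the relations.  Reading off
      coefficients of the image of 1 gives functionals dual to the monomials
      and zero on the left ideal ([dual_functionals]).

    The dual functionals also separate the degrees, which makes the grading of
    the quotient a direct sum, and dimensions n + 1 give the series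
    1 / (1 - x)^2 ([Hquo2_line_module]). *)

Set Implicit Arguments.
Unset Strict Implicit.
Unset Printing Implicit Defensive.

Import GRing.Theory.
Local Open Scope ring_scope.
Local Open Scope quotient_scope.

(** * Presentation of the homogenized algebra *)

Section WordEval.
Variables (S : nzRingType) (x : 'I_4 -> S).

Definition word_eval (w : {fmonom 'I_4}) : S := \prod_(i <- w) x i.

Lemma word_eval_mmorphism : mmorphism word_eval.
Proof.
split=> [w w'|]; rewrite /word_eval; first by rewrite fmM big_cat.
by rewrite fm1 big_nil.
Qed.
HB.instance Definition _ :=
  monalg.isMultiplicative.Build {fmonom 'I_4} S word_eval word_eval_mmorphism.

Lemma word_evalU i : word_eval (fmu i) = x i.
Proof. by rewrite /word_eval fmU big_seq1. Qed.

Lemma comm_word_eval (a : S) w :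
  (forall i, GRing.comm a (x i)) -> GRing.comm a (word_eval w).
Proof. by move=> ax; apply: commr_prod. Qed.
End WordEval.

(** From right to left, this lets values of the generators satisfying the
    relations factor through the presentation; from left to right, it gives the
    relations between the classes of the generators. *)
Lemma relations_killedP (A S : nzRingType) (E : A -> S) (e f h t : A) :
  {morph E : y z / y + z} -> {morph E : y z / y - z} ->
  {morph E : y z / y * z} ->
  (forall r, r \in [:: e * f + f * e - h * t; h * e - e * h; h * f - f * h;
                      e * t - t * e; f * t - t * f; h * t - t * h] -> E r = 0) <->
  [/\ E e * E f + E f * E e = E h * E t, E h * E e = E e * E h
    & E h * E f = E f * E h] /\
  [/\ E e * E t = E t * E e, E f * E t = E t * E f & E h * E t = E t * E h].
Proof.
move=> ED EB EM; split=> [E0|[[r1 r2 r3] [r4 r5 r6]] r]; last first.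
  rewrite !in_cons in_nil.
  by case/or4P=> [||| /or4P[|||//]] /eqP ->;
    rewrite EB ?ED !EM ?r1 ?r2 ?r3 ?r4 ?r5 ?r6 subrr.
by split; split; apply/eqP; rewrite -!EM -?ED -subr_eq0 -EB E0 //
  !inE eqxx ?orbT.
Qed.

Section Universal.
Variables (k : fieldType) (S : nzRingType) (c : {rmorphism k -> S}).
Variable x : 'I_4 -> S.
Hypothesis cx : forall a i, GRing.comm (c a) (x i).
Hypothesis x_rel : [/\ x 0 * x 1 + x 1 * x 0 = x 2%:R * x 3%:R,
  x 2%:R * x 0 = x 0 * x 2%:R & x 2%:R * x 1 = x 1 * x 2%:R].
Hypothesis x_relt : [/\ x 0 * x 3%:R = x 3%:R * x 0,
  x 1 * x 3%:R = x 3%:R * x 1 & x 2%:R * x 3%:R = x 3%:R * x 2%:R].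

Local Notation ev := (mmap c (word_eval x)).

Let evM : {morph ev : y z / y * z}.
Proof.
apply: (commr_mmap_is_multiplicative _).1 => g m m'.
exact: comm_word_eval.
Qed.

Let ev_fgen i : ev (fgen k i) = x i.
Proof.
have -> : ev (fgen k i) = c 1 * word_eval x (fmu i) by exact: mmapU.
by rewrite rmorph1 mul1r word_evalU.
Qed.

Let ev_hideal y : y \in @hideal k -> ev y = 0.
Proof.
have ev_rel r : r \in hrels k -> ev r = 0.
  move: r; apply: (relations_killedP (E := ev) _ _ _ _ _ _ _).2.
  - exact: mmapD.
  - exact: mmapB.
  - exact: evM.
  - by rewrite !ev_fgen.
case/hidealP=> s /allP hs ->; rewrite raddf_sum big_seq big1 //= => p /hs /ev_rel p0.
by rewrite !evM p0 mulr0 mul0r.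
Qed.

(** The scalars act through [c] because the target of interest, matrices over
    k[s, t], is an algebra over k[s, t] rather than over k. *)
Lemma Hhat_universal : exists phi : {rmorphism Hhat k -> S},
  (forall a y, phi (a *: y) = c a * phi y) /\ forall i, phi (hgen k i) = x i.
Proof.
pose phi (y : Hhat k) := ev (repr y).
have phiE y : phi (\pi_(Hhat k) y) = ev y.
  by apply/esym/eqP; rewrite -subr_eq0 -raddfB /= ev_hideal // repr_piB.
have phiB : zmod_morphism phi.
  elim/quotW=> y; elim/quotW=> z.
  rewrite -(raddfB (\pi_(Quotient.quot (@hideal k)))) /=.
  by rewrite (phiE (y - z)) !phiE raddfB.
have phiM : monoid_morphism phi.
  split=> [|]; first by rewrite (phiE 1) mmap1.
  by elim/quotW=> y; elim/quotW=> z; rewrite hpiM !phiE evM.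
pose phiA := GRing.isZmodMorphism.Build _ _ phi phiB.
pose phiMM := GRing.isMonoidMorphism.Build _ _ phi phiM.
pose F : {rmorphism Hhat k -> S} := HB.pack phi phiA phiMM.
exists F; split=> [a|i]; last by rewrite /= phiE ev_fgen.
by elim/quotW=> y; rewrite /= hpiZ !phiE mmapZ.
Qed.
End Universal.

(** * A representation by 2 x 2 matrices over k[s, t] *)

(** The generators e and f in one of the two orders; the relations of the
    algebra are symmetric in e and f. *)
Definition odd_pair (p q : 'I_4) := (p = 0 /\ q = 1) \/ (p = 1 /\ q = 0).

Section Matrix2.
Variable R : comNzRingType.
Definition mx2 (a b c d : R) : 'M[R]_2 :=
  \matrix_(i, j) if i == 0 then (if j == 0 then a else b)
                 else (if j == 0 then c else d).

Lemma ord2P (i : 'I_2) : (i == 0) || (i == 1).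
Proof. by case: i => [[|[|]]]. Qed.

Lemma mx2D a b c d a' b' c' d' :
  mx2 a b c d + mx2 a' b' c' d' = mx2 (a + a') (b + b') (c + c') (d + d').
Proof.
by apply/matrixP => i j; rewrite !mxE; case: (i == 0); case: (j == 0).
Qed.

Lemma mx2M a b c d a' b' c' d' : mx2 a b c d * mx2 a' b' c' d' =
  mx2 (a * a' + b * c') (a * b' + b * d') (c * a' + d * c') (c * b' + d * d').
Proof.
apply/matrixP => i j; rewrite !mxE !big_ord_recl big_ord0 !mxE addr0 /=.
by case: (i == 0); case: (j == 0).
Qed.

Lemma scalar_mx2 a : a%:M = mx2 a 0 0 a.
Proof.
apply/matrixP => i j; rewrite !mxE.
by case/orP: (ord2P i) => /eqP ->; case/orP: (ord2P j) => /eqP ->.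
Qed.
End Matrix2.

Section Representation.
Variables (k : fieldType) (p q : 'I_4) (beta lambda mu : k).
Hypothesis pq : odd_pair p q.

Local Notation R := {poly {poly k}}.
Let s : R := 'X.
Let t : R := 'X%:P.
Let cst (a : k) : R := a%:P%:P.

(** Matrices of the generators on the basis 1, q of k[q, t] over k[s, t], with
    s = q^2.  Columns are images: p sends 1 to mu t - beta q, as w - mu t kills
    1, and sends q to h t - q (p 1) = lambda t^2 + beta s - mu t q. *)
Definition mx_p := mx2 (cst mu * t) (cst lambda * t ^+ 2 + cst beta * s)
  (- cst beta) (- (cst mu * t)).
Definition mx_q : 'M[R]_2 := mx2 0 s 1 0.
Definition mx_gen (i : 'I_4) : 'M[R]_2 :=
  if i == p then mx_p else if i == q then mx_q
  else if i == 2%:R then (cst lambda * t)%:M else t%:M.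

Let sC (a : R) (A : 'M[R]_2) : a%:M * A = A * a%:M.
Proof. exact: esym (scalar_mxC a A). Qed.

Let sM (a b : R) : a%:M * b%:M = (a * b)%:M :> 'M[R]_2.
Proof. exact: esym (scalar_mxM 2 a b). Qed.

Let sE (a : R) (A : 'M[R]_2) i j : (a%:M * A) i j = a * A i j.
Proof. by have -> : a%:M * A = a *: A by [exact: mul_scalar_mx]; rewrite mxE. Qed.

Let sw : mx_p * mx_q + mx_q * mx_p = (cst lambda * t)%:M * t%:M.
Proof.
rewrite !scalar_mx2 !mx2M mx2D; congr mx2; ring.
Qed.

Lemma mx_genE : [/\ mx_gen p = mx_p, mx_gen q = mx_q,
  mx_gen 2%:R = (cst lambda * t)%:M & mx_gen 3%:R = t%:M].
Proof. by rewrite /mx_gen !eqxx; case: pq => [[-> ->]|[-> ->]]. Qed.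

Lemma mx_gen_rel :
  [/\ mx_gen 0 * mx_gen 1 + mx_gen 1 * mx_gen 0 = mx_gen 2%:R * mx_gen 3%:R,
  mx_gen 2%:R * mx_gen 0 = mx_gen 0 * mx_gen 2%:R
  & mx_gen 2%:R * mx_gen 1 = mx_gen 1 * mx_gen 2%:R] /\
  [/\ mx_gen 0 * mx_gen 3%:R = mx_gen 3%:R * mx_gen 0,
  mx_gen 1 * mx_gen 3%:R = mx_gen 3%:R * mx_gen 1
  & mx_gen 2%:R * mx_gen 3%:R = mx_gen 3%:R * mx_gen 2%:R].
Proof.
have [gp gq -> ->] := mx_genE.
split; split.
- case: pq gp gq => [[-> ->]|[-> ->]] -> ->; [exact: sw|].
  by rewrite addrC.
all: first [exact: sC | exact: esym (sC _ _)].
Qed.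

Lemma mx_qX j : mx_q ^+ j = (s ^+ j./2)%:M * (if odd j then mx_q else 1).
Proof.
have qq : mx_q * mx_q = s%:M.
  by rewrite scalar_mx2 mx2M; congr mx2; ring.
elim: j => [|j IH]; first by rewrite expr0 mul1r.
rewrite exprSr IH -mulrA /= uphalf_half; case: (odd j) => /=.
  by rewrite qq mulr1 add1n exprSr sM.
by rewrite mul1r.
Qed.

(** [kappa i l y] is the coefficient of q^i t^l in the image of 1 under y. *)
Lemma dual_functionals : exists kappa : nat -> nat -> Hhat k -> k,
  [/\ forall i l, zmod_morphism (kappa i l),
      forall i l a y, kappa i l (a *: y) = a * kappa i l y,
      forall i l y, kappa i l (y * (hgen k 2%:R - lambda *: hgen k 3%:R)) = 0,
      forall i l y,
        kappa i l (y * (hgen k p + beta *: hgen k q - mu *: hgen k 3%:R)) = 0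
    & forall i l j m,
        kappa i l (hgen k q ^+ j * hgen k 3%:R ^+ m) = ((i == j) && (l == m))%:R].
Proof.
pose c : {rmorphism k -> 'M[R]_2} := @scalar_mx R 2 \o (polyC \o polyC).
have cx a i : GRing.comm (c a) (mx_gen i) by exact: sC.
have [rel relt] := mx_gen_rel.
have [phi [phiZ phig]] := Hhat_universal cx rel relt.
have [gp gq gh gt] := mx_genE.
pose r i : 'I_2 := if odd i then 1 else 0.
(* q^i is the basis vector number [odd i] times s^(i/2), and column 0 is the
   image of 1; the outer variable of the entries is s, the inner one is t. *)
exists (fun i l y => (phi y (r i) 0)`_(i./2)`_l); split.
- by move=> i l y z; rewrite rmorphB !mxE !coefB.
- by move=> i l a y; rewrite phiZ /= sE !coefCM.
- move=> i l y; rewrite rmorphM rmorphB phiZ !phig gh gt /= sM subrr.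
  by rewrite mulr0 mxE !coef0.
- move=> i l y; rewrite rmorphM rmorphB rmorphD !phiZ !phig gp gq gt /=.
  (* w - mu t kills 1, so its first column vanishes. *)
  set v := _ - _; suff v0 j : v j 0 = 0.
    by rewrite mxE big1 ?coef0 // => j _; rewrite v0 mulr0.
  rewrite /v !scalar_mx2 !mx2M mx2D !mxE; case: (j == 0) => /=; ring.
- move=> i l j m; rewrite rmorphM !rmorphXn !phig gq gt mx_qX.
  set A : 'M[R]_2 := if odd j then mx_q else 1.
  have A0 : A (r i) 0 = (odd i == odd j)%:R.
    by rewrite /A /r; case: (odd i); case: (odd j); rewrite !mxE.
  have -> : (s ^+ j./2)%:M * A * t%:M ^+ m = (s ^+ j./2 * t ^+ m)%:M * A.
    by rewrite -rmorphXn -mulrA -sC mulrA sM.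
  have -> : i == j = (odd i == odd j) && (i./2 == j./2).
    by rewrite -{1}[i]odd_double_half -{1}[j]odd_double_half; lia.
  rewrite sE A0 /s /t -[_%:P ^+ m]rmorphXn.
  case: (odd i == odd j) => /=; last by rewrite mulr0 !coef0.
  rewrite mulr1 coefMC coefXn.
  case: (i./2 == j./2); last by rewrite mul0r coef0.
  by rewrite mul1r coefXn.
Qed.
End Representation.

(** * Homogeneous elements *)

Section Degree.
Variable k : fieldType.
Local Notation freealg := {malg k[{fmonom 'I_4}]}.
Implicit Types (x y : Hhat k) (n m : int).

Let piD (a b : freealg) : \pi_(Hhat k) (a + b) = \pi_(Hhat k) a + \pi_(Hhat k) b.
Proof. exact: (raddfD (\pi_(Quotient.quot (@hideal k)))). Qed.

Let pi0 : \pi_(Hhat k) 0 = 0.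
Proof. exact: (raddf0 (\pi_(Quotient.quot (@hideal k)))). Qed.

Let pi_sum (I : Type) (r : seq I) (F : I -> freealg) :
  \pi_(Hhat k) (\sum_(i <- r) F i) = \sum_(i <- r) \pi_(Hhat k) (F i).
Proof. exact: (raddf_sum (\pi_(Quotient.quot (@hideal k)))). Qed.

Lemma Hdeg0 n : Hdeg n (0 : Hhat k).
Proof. by exists 0; rewrite ?pi0 // => w; rewrite mcoeff0 eqxx. Qed.

Lemma HdegD n x y : Hdeg n x -> Hdeg n y -> Hdeg n (x + y).
Proof.
move=> [a ha ->] [b hb ->]; exists (a + b); last by rewrite piD.
move=> w; rewrite mcoeffD; have [a0|/ha //] := eqVneq a@_w 0.
by rewrite a0 add0r => /hb.
Qed.

Lemma HdegZ n (c : k) x : Hdeg n x -> Hdeg n (c *: x).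
Proof.
move=> [a ha ->]; exists (c *: a); last by rewrite hpiZ.
move=> w; rewrite mcoeffZ => caw; apply: ha.
by apply: contraNneq caw => ->; rewrite mulr0.
Qed.

Lemma HdegM n m x y : Hdeg n x -> Hdeg m y -> Hdeg (n + m) (x * y).
Proof.
move=> [a ha ->] [b hb ->]; exists (a * b); last by rewrite hpiM.
move=> w; rewrite mcoeff_neq0 => /msuppM_le [w1 [w2 []]].
rewrite -!mcoeff_neq0 => /ha <- /hb <- ->.
by rewrite fdegM PoszD.
Qed.

Lemma Hdeg1 : Hdeg 0 (1 : Hhat k).
Proof.
exists 1 => // w; rewrite mcoeff1; case: (w =P mone) => [-> _|_];
  first by rewrite fdeg1.
by rewrite eqxx.
Qed.

Lemma Hdeg_gen i : Hdeg 1 (hgen k i).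
Proof.
exists (fgen k i) => // w; rewrite mcoeffU1.
case: (fmu i =P w) => [<- _|_]; first by rewrite fdegU.
by rewrite eqxx.
Qed.

Lemma HdegX i j : Hdeg j%:Z (hgen k i ^+ j).
Proof.
elim: j => [|j IH]; first exact: Hdeg1.
by rewrite exprS -add1n PoszD; apply: HdegM => //; exact: Hdeg_gen.
Qed.

Lemma pi_word (c : k) (w : {fmonom 'I_4}) :
  \pi_(Hhat k) << c *g w >> = c *: \prod_(i <- w) hgen k i.
Proof.
have -> : << c *g w >> = c *: << w >> :> freealg.
  by apply/malgP => w'; rewrite mcoeffZ !mcoeffU mulrnAr mulr1.
rewrite -hpiZ; congr (_ *: _); case: w => w /=; elim: w => [|i w IH].
  by rewrite big_nil -fmoneE.
have -> : << FMonom (i :: w) >> = fgen k i * << FMonom w >> :> freealg.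
  rewrite malgM_def fgmulUU mulr1; congr << _ *g _ >>.
  by rewrite -[RHS]fmK fmM fmU.
by rewrite -hpiM IH big_cons.
Qed.

(** A homogeneous element is a combination of words in the generators of its
    degree, so a property stable under combinations is checked on words. *)
Lemma Hdeg_ind n (P : Hhat k -> Prop) : P 0 ->
  (forall x y, P x -> P y -> P (x + y)) ->
  (forall (c : k) x, P x -> P (c *: x)) ->
  (forall w : seq 'I_4, (size w)%:Z = n -> P (\prod_(i <- w) hgen k i)) ->
  forall x, Hdeg n x -> P x.
Proof.
move=> P0 PD PZ Pw x [a ha ->]; rewrite [a]monalgE pi_sum big_seq.
apply: (big_ind P) => // w; rewrite -mcoeff_neq0 => /ha wn.
by rewrite pi_word; apply: PZ; apply: Pw.
Qed.

Lemma Hdeg_neg (n : nat) x : Hdeg (Negz n) x -> x = 0.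
Proof.
by apply: (Hdeg_ind (P := fun x => x = 0)) => // [_ _ -> ->|c _ ->];
  rewrite ?addr0 ?scaler0.
Qed.

Lemma Hdeg_decomp x : exists (s : seq int) (y : int -> Hhat k),
  (forall n, Hdeg n (y n)) /\ x = \sum_(n <- s) y n.
Proof.
elim/quotW: x => a.
pose y n : Hhat k :=
  \sum_(w <- msupp a | n == (fdeg w)%:Z) a@_w *: \prod_(i <- w) hgen k i.
exists (undup [seq (fdeg w)%:Z | w <- msupp a]), y; split=> [n|].
  apply: (big_ind (Hdeg n)) => [|y1 y2|w /eqP ->]; [exact: Hdeg0|exact: HdegD|].
  exists << a@_w *g w >>; last by rewrite pi_word.
  by move=> w'; rewrite mcoeffU; case: (w =P w') => [->|]; rewrite ?eqxx.
rewrite [in LHS](monalgE a) pi_sum (exchange_big_dep xpredT) //=.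
rewrite big_seq [RHS]big_seq; apply: eq_bigr => w wa.
set r := undup _; have wr : (fdeg w)%:Z \in r by rewrite mem_undup map_f.
rewrite pi_word -[RHS]big_filter.
have -> : [seq n <- r | n == (fdeg w)%:Z] = [:: (fdeg w)%:Z].
  by apply: filter_pred1_uniq => //; exact: undup_uniq.
by rewrite big_seq1.
Qed.
End Degree.

(** * Reduction to monomials modulo a left ideal *)

Section NormalForm.
Variables (k : fieldType) (A : algType k) (J : zmodClosed A).
Hypothesis JM : forall a x, x \in J -> a * x \in J.
Variables (w g h t : A) (lambda mu d : k).
Hypotheses (tg : GRing.comm t g) (th : GRing.comm t h) (tw : GRing.comm t w).
Hypothesis hg : h * g = g * h.
Hypothesis wg : w * g = - (g * w) + h * t + d *: g ^+ 2.
Hypothesis hJ : h - lambda *: t \in J.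
Hypothesis wJ : w - mu *: t \in J.

(** The degree n is kept because the monomials must be homogeneous of the same
    degree as the element they represent. *)
Definition normal_mod (n : nat) (x : A) : Prop :=
  exists c : 'I_n.+1 -> k, x - \sum_i c i *: (g ^+ i * t ^+ (n - i)) \in J.

Let JZ (c : k) x : x \in J -> c *: x \in J.
Proof. by move=> xJ; rewrite -[x]mul1r scalerAl JM. Qed.

Lemma normal_modJ n x y : x - y \in J -> normal_mod n y -> normal_mod n x.
Proof.
move=> xy [c yc]; exists c.
by rewrite -[x](subrK y) -addrA rpredD.
Qed.

Lemma normal_mod0 n : normal_mod n 0.
Proof.
by exists (fun=> 0); rewrite big1 ?subr0 ?rpred0 // => i _; rewrite scale0r.
Qed.

Lemma normal_modD n x y : normal_mod n x -> normal_mod n y -> normal_mod n (x + y).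
Proof.
move=> [c xc] [c' yc]; exists (fun i => c i + c' i).
under eq_bigr do rewrite scalerDl.
by rewrite big_split opprD addrACA rpredD.
Qed.

Lemma normal_modZ n (a : k) x : normal_mod n x -> normal_mod n (a *: x).
Proof.
move=> [c xc]; exists (fun i => a * c i).
under eq_bigr do rewrite -scalerA.
by rewrite -scaler_sumr -scalerBr JZ.
Qed.

Lemma normal_mod_monomial i j : normal_mod (i + j) (g ^+ i * t ^+ j).
Proof.
have lt_i : (i < (i + j).+1)%N by rewrite ltnS leq_addr.
exists (fun l => (l == Ordinal lt_i)%:R).
rewrite (bigD1 (Ordinal lt_i)) //= eqxx scale1r addKn big1 ?addr0 ?subrr ?rpred0 //.
by move=> l /negPf ->; rewrite scale0r.
Qed.

(** It suffices to test left multiplication on monomials since [J] is a left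
    ideal; see [raisesP]. *)
Definition raises (s : A) := forall i j, normal_mod (i + j).+1 (s * (g ^+ i * t ^+ j)).

Lemma raisesP s n x : raises s -> normal_mod n x -> normal_mod n.+1 (s * x).
Proof.
move=> sr [c xc].
apply: (@normal_modJ _ _ (s * \sum_i c i *: (g ^+ i * t ^+ (n - i)))).
  by rewrite -mulrBr JM.
rewrite mulr_sumr; apply: big_ind; [exact: normal_mod0|exact: normal_modD|].
move=> i _; rewrite -scalerAr; apply: normal_modZ.
by have := sr i (n - i)%N; rewrite subnKC // -ltnS.
Qed.

Lemma raisesD r s : raises r -> raises s -> raises (r + s).
Proof. by move=> rr rs i j; rewrite mulrDl; exact: normal_modD. Qed.

Lemma raisesZ c s : raises s -> raises (c *: s).
Proof. by move=> rs i j; rewrite -scalerAl; exact: normal_modZ. Qed.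

Lemma raises_g : raises g.
Proof. by move=> i j; rewrite mulrA -exprS -addSn; exact: normal_mod_monomial. Qed.

Lemma raises_t : raises t.
Proof.
move=> i j; have tX : GRing.comm t (g ^+ i * t ^+ j).
  by apply: commrM; [exact: commrX|exact: commrX].
rewrite tX -mulrA -exprSr -addnS; exact: normal_mod_monomial.
Qed.

(** h commutes with g and t, so it reaches the right end, where it is
    congruent to lambda t. *)
Lemma raises_h : raises h.
Proof.
move=> i j; apply: (@normal_modJ _ _ (lambda *: (g ^+ i * t ^+ j.+1))); last first.
  by rewrite -addnS; apply: normal_modZ; exact: normal_mod_monomial.
have hX : GRing.comm h (g ^+ i * t ^+ j).
  by apply: commrM; apply: commrX => //; exact: commr_sym.
have -> : h * (g ^+ i * t ^+ j) - lambda *: (g ^+ i * t ^+ j.+1) =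
    (g ^+ i * t ^+ j) * (h - lambda *: t).
  by rewrite mulrBr hX exprSr mulrA scalerAr.
exact: JM.
Qed.

(** By induction on the exponent of g: the commutation rule moves w past one
    g, at the cost of terms without w that are already monomials up to h, and
    for exponent 0, w commutes with t and meets the ideal. *)
Lemma raises_w : raises w.
Proof.
elim=> [|i IH] j.
  rewrite expr0 mul1r add0n.
  apply: (@normal_modJ _ _ (mu *: (g ^+ 0 * t ^+ j.+1))); last first.
    by apply: normal_modZ; exact: (normal_mod_monomial 0).
  have -> : w * t ^+ j - mu *: (g ^+ 0 * t ^+ j.+1) = t ^+ j * (w - mu *: t).
    rewrite mul1r mulrBr exprSr scalerAr; congr (_ - _).
    by apply: commrX; exact: commr_sym.
  exact: JM.
have -> : w * (g ^+ i.+1 * t ^+ j) =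
    (-1) *: (g * (w * (g ^+ i * t ^+ j))) + h * (t * (g ^+ i * t ^+ j)) +
    d *: (g ^+ i.+2 * t ^+ j).
  have gS l : g ^+ l.+1 * t ^+ j = g * (g ^+ l * t ^+ j) by rewrite exprS mulrA.
  rewrite !gS; move: (g ^+ i * t ^+ j) => z.
  by rewrite !mulrA wg !mulrDl scaleN1r mulNr -scalerAl expr2.
have IHt := raisesP raises_h (raises_t i j).
rewrite addSn.
apply: normal_modD; first apply: normal_modD; last first.
- by rewrite -!addSn; apply: normal_modZ; exact: normal_mod_monomial.
- exact: IHt.
- by apply: normal_modZ; apply: (raisesP raises_g); exact: IH.
Qed.

Lemma normal_mod_word (I : Type) (x : I -> A) (r : seq I) :
  (forall i, raises (x i)) -> normal_mod (size r) (\prod_(i <- r) x i).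
Proof.
move=> xr; elim: r => [|i r IH].
  by rewrite big_nil; have := normal_mod_monomial 0 0; rewrite !expr0 mulr1.
by rewrite big_cons; exact: raisesP.
Qed.
End NormalForm.

(** * When a cyclic quotient is a line module *)

(** The coefficients of 1 / (1 - x)^2. *)
Lemma line_series_succn : is_line_series succn.
Proof.
have cE j : ((1 - 'X) ^+ 2 : {poly int})`_j =
    (j == 0%N)%:R - 2%:R * (j == 1%N)%:R + (j == 2%N)%:R.
  have -> : (1 - 'X) ^+ 2 = 1 - 'X *+ 2 + 'X^2 :> {poly int} by ring.
  by rewrite !(coefD, coefN, coefMn, coef1, coefX, coefXn) mulr_natl.
move=> n; under eq_bigr do rewrite cE.
case: n => [|[|n]]; first by rewrite big_ord_recr big_ord0.
  by rewrite !big_ord_recr big_ord0.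
rewrite !big_ord_recr big1 => [|i _] /=.
  have [-> -> ->] : [/\ (n.+2 - n = 2)%N, (n.+2 - n.+1 = 1)%N & (n.+2 - n.+2 = 0)%N].
    by split; lia.
  by rewrite /=; lia.
have /=lt_i := ltn_ord i.
have [-> -> ->] : [/\ (n.+2 - i == 0)%N = false, (n.+2 - i == 1)%N = false
    & (n.+2 - i == 2)%N = false] by split; apply/eqP; lia.
by rewrite !mulr0.
Qed.

Section Relations.
Variable k : fieldType.
Local Notation gen := (hgen k).

Let rel_pi0 r : r \in hrels k -> \pi_(Hhat k) r = 0.
Proof.
move=> hr; have -> : 0 = \pi_(Hhat k) 0.
  exact: esym (raddf0 (\pi_(Quotient.quot (@hideal k)))).
apply/eqP; rewrite hpiE subr0; apply/hidealP.
exists [:: (1, r, 1)]; first by rewrite /= hr.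
by rewrite big_seq1 /= mul1r mulr1.
Qed.

Let piB a b : \pi_(Hhat k) (a - b) = \pi_(Hhat k) a - \pi_(Hhat k) b.
Proof. exact: (raddfB (\pi_(Quotient.quot (@hideal k)))). Qed.

Let piD a b : \pi_(Hhat k) (a + b) = \pi_(Hhat k) a + \pi_(Hhat k) b.
Proof. exact: (raddfD (\pi_(Quotient.quot (@hideal k)))). Qed.

Lemma hgen_rel :
  [/\ gen 0 * gen 1 + gen 1 * gen 0 = gen 2%:R * gen 3%:R,
  gen 2%:R * gen 0 = gen 0 * gen 2%:R & gen 2%:R * gen 1 = gen 1 * gen 2%:R] /\
  [/\ gen 0 * gen 3%:R = gen 3%:R * gen 0,
  gen 1 * gen 3%:R = gen 3%:R * gen 1
  & gen 2%:R * gen 3%:R = gen 3%:R * gen 2%:R].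
Proof.
apply: (relations_killedP (E := \pi_(Hhat k)) _ _ _ _ _ _ _).1 rel_pi0.
- exact: piD.
- exact: piB.
- by move=> a b; rewrite hpiM.
Qed.
End Relations.

Section Quotient.
Variables (k : fieldType) (u v : Hhat k).
Local Notation J := (lideal2 u v).
Local Notation Q := (Hquo2 u v).
Implicit Types (x y : Hhat k).

Lemma qpiD x y : \pi_Q (x + y) = \pi_Q x + \pi_Q y.
Proof. exact: (raddfD (\pi_(Quotient.quot J))). Qed.

Lemma qpi0 : \pi_Q 0 = 0.
Proof. exact: (raddf0 (\pi_(Quotient.quot J))). Qed.

Lemma qpi_sum (I : Type) (r : seq I) (F : I -> Hhat k) :
  \pi_Q (\sum_(i <- r) F i) = \sum_(i <- r) \pi_Q (F i).
Proof. exact: (raddf_sum (\pi_(Quotient.quot J))). Qed.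

Lemma qpiE x y : (\pi_Q x == \pi_Q y) = (x - y \in J).
Proof. by rewrite Quotient.idealrBE. Qed.

Lemma qpi_eq0 x : (\pi_Q x == 0) = (x \in J).
Proof. by rewrite -qpi0 qpiE subr0. Qed.

Lemma repr_qpiB x : x - repr (\pi_Q x) \in J.
Proof. by rewrite -qpiE reprK. Qed.

Lemma qpiM x y : x *: \pi_Q y = \pi_Q (x * y) :> Q.
Proof. exact: qscaleE. Qed.

Lemma qpiZ (c : k) x : c%:A *: \pi_Q x = \pi_Q (c *: x) :> Q.
Proof. by rewrite qpiM mulr_algl. Qed.

Section LineModule.
Variable g : Hhat k.
Local Notation t := (hgen k 3%:R).
Variable kappa : nat -> nat -> Hhat k -> k.
Hypothesis kappaB : forall i l, zmod_morphism (kappa i l).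
Hypothesis kappaZ : forall i l a y, kappa i l (a *: y) = a * kappa i l y.
Hypothesis kappaJ : forall i l y, y \in J -> kappa i l y = 0.
Hypothesis kappa_dual : forall i l j m,
  kappa i l (g ^+ j * t ^+ m) = ((i == j) && (l == m))%:R.
Hypothesis g1 : forall j : nat, Hdeg j%:Z (g ^+ j).
Hypothesis normalP : forall (n : nat) x, Hdeg n%:Z x -> normal_mod J g t n x.

Let kappaE i l := GRing.isZmodMorphism.Build _ _ (kappa i l) (kappaB i l).
Let K i l : {additive Hhat k -> k} := HB.pack (kappa i l) (kappaE i l).

Let kappa_eqJ i l x y : x - y \in J -> kappa i l x = kappa i l y.
Proof. by move/(kappaJ i l); rewrite kappaB => /eqP; rewrite subr_eq0 => /eqP. Qed.

Let kappa0 i l : kappa i l 0 = 0. Proof. exact: (raddf0 (K i l)). Qed.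

Let kappa_sum (I : Type) (r : seq I) (F : I -> Hhat k) i l :
  kappa i l (\sum_(j <- r) F j) = \sum_(j <- r) kappa i l (F j).
Proof. exact: (raddf_sum (K i l)). Qed.

Let monomial n (i : 'I_n.+1) := g ^+ i * t ^+ (n - i).

Let kappa_monomials n (c : 'I_n.+1 -> k) (i : 'I_n.+1) :
  kappa i (n - i) (\sum_j c j *: monomial j) = c i.
Proof.
rewrite kappa_sum (bigD1 i) //= kappaZ kappa_dual !eqxx mulr1 big1 ?addr0 //.
move=> j /negPf ji; rewrite kappaZ kappa_dual.
by rewrite -[_ == _ :> nat]/(i == j) eq_sym ji mulr0.
Qed.

(** The functionals see only their own degree; this separates the components
    of the quotient. *)
Let kappa_homog n x i l : Hdeg n x -> n <> (i + l)%:Z -> kappa i l x = 0.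
Proof.
case: n => n; last by move/Hdeg_neg => ->.
move/normalP => [c /kappa_eqJ ->] nil.
rewrite kappa_sum big1 // => j _; rewrite kappaZ kappa_dual.
have /= := ltn_ord j => jn.
case: eqP => [ij|]; last by rewrite mulr0.
case: eqP => [lj|]; last by rewrite mulr0.
by case: nil; congr Posz; lia.
Qed.

(** In each degree the functionals determine an element modulo the ideal. *)
Let kappa_mono (n : nat) x : Hdeg n%:Z x ->
  (forall i : 'I_n.+1, kappa i (n - i) x = 0) -> x \in J.
Proof.
move/normalP => [c xc] x0.
have c0 i : c i = 0 by rewrite -(kappa_monomials c) -(kappa_eqJ _ _ xc) x0.
by move: xc; rewrite big1 ?subr0 // => i _; rewrite c0 scale0r.
Qed.

Let monomial_deg n (i : 'I_n.+1) : Hdeg n%:Z (monomial i).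
Proof.
have /= := ltn_ord i; rewrite ltnS => le_in.
have -> : n%:Z = (i%:Z + (n - i)%N%:Z)%R by rewrite -PoszD subnKC.
by apply: HdegM; [exact: g1|exact: HdegX].
Qed.

Let kappaQ i l (z : Q) := kappa i l (repr z).

Let kappaQE i l x : kappaQ i l (\pi_Q x) = kappa i l x.
Proof. exact/esym/kappa_eqJ/repr_qpiB. Qed.

Let kappaQ_sum (I : Type) (r : seq I) (F : I -> Q) i l :
  kappaQ i l (\sum_(j <- r) F j) = \sum_(j <- r) kappaQ i l (F j).
Proof.
apply: (big_morph (kappaQ i l)) => [y z|]; last by rewrite -qpi0 kappaQE kappa0.
rewrite -[y]reprK -[z]reprK -qpiD !kappaQE; exact: (raddfD (K i l)).
Qed.

Lemma Hquo2_grading : is_grading (@Hquo2_deg k u v).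
Proof.
split.
- move=> n; split; first by exists 0; [exact: Hdeg0|rewrite qpi0].
  by move=> _ _ [a an ->] [b bn ->]; exists (a + b); [exact: HdegD|rewrite qpiD].
- move=> i j a _ ai [b bj ->]; exists (a * b); [exact: HdegM|exact: qpiM].
- elim/quotW=> x; have [s [y [yn ->]]] := Hdeg_decomp x.
  exists s, (fun n => \pi_Q (y n)); split; last by rewrite qpi_sum.
  by move=> n; exists (y n).
- move=> s y us yn sum0 n ns; have [x xn yE] := yn n; rewrite yE.
  case: n => n in ns xn yE *; last by rewrite (Hdeg_neg xn) qpi0.
  apply/eqP; rewrite qpi_eq0; apply: kappa_mono xn _ => i.
  have := kappaQ_sum s y i (n - i).
  rewrite sum0 -qpi0 kappaQE kappa0 (bigD1_seq _ ns us) /= yE kappaQE big1 ?addr0 //.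
  move=> m mn; have [z zm ->] := yn m; rewrite kappaQE; apply: kappa_homog zm _.
  have /= := ltn_ord i; rewrite ltnS => le_in.
  by rewrite subnKC //; exact/eqP.
Qed.

Lemma Hquo2_line_module : is_line_module (@Hquo2_deg k u v).
Proof.
split.
- exact: Hquo2_grading.
- exists 0, (\pi_Q 1); split; first by exists 1; [exact: Hdeg1|].
  by elim/quotW=> x; exists x; rewrite qpiM mulr1.
- move=> n; exists (fun=> 0); split=> [c _ []//|z]; split.
    by move=> [a /Hdeg_neg -> ->]; exists (fun=> 0); rewrite big_ord0 qpi0.
  by move=> [c ->]; exists 0; [exact: Hdeg0|rewrite big_ord0 qpi0].
- exists succn; split; last exact: line_series_succn.
  have sumE (n : nat) (c : 'I_n.+1 -> k) :
      \sum_i (c i)%:A *: \pi_Q (monomial i) = \pi_Q (\sum_i c i *: monomial i).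
    by rewrite qpi_sum; apply: eq_bigr => i _; rewrite qpiZ.
  move=> n; exists (fun i => \pi_Q (monomial i)); split=> [c|z].
    by rewrite sumE => /eqP; rewrite qpi_eq0 => cJ i; rewrite -(kappa_monomials c) kappaJ.
  split=> [[a /normalP [c ac] ->]|[c ->]].
    by exists c; rewrite sumE; apply/eqP; rewrite qpiE.
  exists (\sum_i c i *: monomial i); last by rewrite sumE.
  apply: (big_ind (Hdeg n%:Z)); [exact: Hdeg0|exact: HdegD|].
  by move=> i _; exact/HdegZ/monomial_deg.
Qed.
End LineModule.
End Quotient.

(** * Left ideals generated by two elements *)

Section LineModules.
Variable k : fieldType.
Local Notation gen := (hgen k).

Lemma lideal2P (u v x : Hhat k) :
  reflect (exists a b, x = a * u + b * v) (x \in lideal2 u v).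
Proof. exact: asboolP. Qed.

Lemma lideal2Z (u v : Hhat k) (c : k) x :
  x \in lideal2 u v -> c *: x \in lideal2 u v.
Proof. by move=> xJ; rewrite -[x]mul1r scalerAl lideal2Ml. Qed.

Lemma lideal2l (u v : Hhat k) : u \in lideal2 u v.
Proof. by apply/lideal2P; exists 1, 0; rewrite mul1r mul0r addr0. Qed.

Lemma lideal2r (u v : Hhat k) : v \in lideal2 u v.
Proof. by apply/lideal2P; exists 0, 1; rewrite mul1r mul0r add0r. Qed.

Lemma odd_pair_rel p q : odd_pair p q ->
  [/\ gen p * gen q + gen q * gen p = gen 2%:R * gen 3%:R,
      gen 2%:R * gen q = gen q * gen 2%:R,
      gen 3%:R * gen p = gen p * gen 3%:R &
      gen 3%:R * gen q = gen q * gen 3%:R].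
Proof.
have [[r1 r2 r3] [r4 r5 r6]] := hgen_rel k.
case=> [[-> ->]|[-> ->]].
  exact: And4 r1 r3 (esym r4) (esym r5).
exact: And4 (etrans (addrC _ _) r1) r2 (esym r5) (esym r4).
Qed.

Lemma odd_pair_cases p q i : odd_pair p q ->
  [\/ i = p, i = q, i = 2%:R | i = 3%:R].
Proof.
case: i => [[|[|[|[|i]]]] lt_i] // [[-> ->]|[-> ->]];
  by [left; apply: val_inj|right; left; apply: val_inj
     |constructor 1; apply: val_inj|constructor 2; apply: val_inj
     |constructor 3; apply: val_inj|constructor 4; apply: val_inj].
Qed.

Section OddPair.
Variables (p q : 'I_4) (c beta lambda mu : k) (u v : Hhat k).
Hypotheses (pq : odd_pair p q) (c0 : c != 0).
Hypothesis uE : u = gen 2%:R - lambda *: gen 3%:R.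
Hypothesis vE : v = c *: (gen p + beta *: gen q - mu *: gen 3%:R).

Let w := gen p + beta *: gen q.

Let normal_form n x : Hdeg n%:Z x -> normal_mod (lideal2 u v) (gen q) (gen 3%:R) n x.
Proof.
have [rpq hq tp tq] := odd_pair_rel pq.
have [_ [_ _ ht]] := hgen_rel k.
have uJ : gen 2%:R - lambda *: gen 3%:R \in lideal2 u v.
  by rewrite -uE lideal2l.
have wJ : w - mu *: gen 3%:R \in lideal2 u v.
  by rewrite -[_ - _](scalerK c0) -vE lideal2Z ?lideal2r.
have tw : GRing.comm (gen 3%:R) w.
  by rewrite /GRing.comm mulrDr mulrDl -scalerAr -scalerAl tp tq.
have wq : w * gen q = - (gen q * w) + gen 2%:R * gen 3%:R
    + (beta + beta) *: gen q ^+ 2.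
  rewrite -rpq mulrDr mulrDl -scalerAr -scalerAl expr2 scalerDl.
  move: (gen p * gen q) (gen q * gen p) (beta *: _) => x1 x2 x3.
  by rewrite -[RHS]addrA [x1 + x2 + _]addrACA addrC addrK.
have JM := @lideal2Ml k u v.
have raise i : raises (lideal2 u v) (gen q) (gen 3%:R) (gen i).
  have rq := raises_g (lideal2 u v) (gen q) (gen 3%:R).
  have rh := raises_h JM (esym ht) hq uJ.
  have rw := raises_w JM tq (esym ht) tw hq wq uJ wJ.
  case: (odd_pair_cases i pq) => ->; [|exact: rq|exact: rh|exact: raises_t].
  have -> : gen p = w + (- beta) *: gen q by rewrite scaleNr addrK.
  by apply: raisesD; [exact: rw|exact: raisesZ].
apply: Hdeg_ind => [|||r [<-]].
- exact: normal_mod0.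
- by move=> y z; exact: normal_modD.
- by move=> a y; exact: normal_modZ.
- exact (normal_mod_word JM r raise).
Qed.

Lemma odd_pair_line_module : is_line_module (@Hquo2_deg k u v).
Proof.
have [kappa [kB kZ ku kv kd]] := dual_functionals beta lambda mu pq.
apply: (Hquo2_line_module kB kZ _ kd); last exact: normal_form; last exact: HdegX.
move=> i l y /lideal2P[a [b ->]].
rewrite -[b * v]opprK kB -mulNr uE ku sub0r vE -scalerAr kZ kv.
by rewrite mulr0 oppr0.
Qed.
End OddPair.

(** If alpha is nonzero, f is the surviving odd generator and w is scaled to
    e + (beta / alpha) f; otherwise w is a multiple of f and e survives. *)
Lemma Hquo2_line_moduleP (alpha beta lambda mu : k) u v :
  (alpha, beta) != (0, 0) ->
  u = gen 2%:R - lambda *: gen 3%:R ->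
  v = alpha *: gen 0 + beta *: gen 1 - mu *: gen 3%:R ->
  is_line_module (@Hquo2_deg k u v).
Proof.
move=> ab0 uE vE; have [a0|a0] := eqVneq alpha 0.
  have b0 : beta != 0 by apply: contraNneq ab0 => ->; rewrite a0.
  apply: (@odd_pair_line_module 1 0 beta 0 lambda (beta^-1 * mu) _ _
    (or_intror (conj erefl erefl)) b0 uE).
  rewrite vE a0 scale0r add0r addr0 scalerBr scalerA (mulVKf b0 mu).
  exact: erefl.
apply: (@odd_pair_line_module 0 1 alpha (alpha^-1 * beta) lambda
  (alpha^-1 * mu) _ _ (or_introl (conj erefl erefl)) a0 uE).
rewrite vE scalerBr scalerDr !scalerA (mulVKf a0 mu) (mulVKf a0 beta).
exact: erefl.
Qed.

(** The quotients by two equal left ideals are distinct types when the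
    generators differ; the isomorphism is induced by the identity. *)
Lemma graded_iso_lideal2 (u v u' v' : Hhat k) : lideal2 u v =i lideal2 u' v' ->
  graded_iso (@Hquo2_deg k u v) (@Hquo2_deg k u' v').
Proof.
move=> eqJ.
pose F (x : Hquo2 u v) : Hquo2 u' v' := \pi_(Hquo2 u' v') (repr x).
pose G (x : Hquo2 u' v') : Hquo2 u v := \pi_(Hquo2 u v) (repr x).
have FE x : F (\pi_(Hquo2 u v) x) = \pi_(Hquo2 u' v') x.
  by apply/eqP; rewrite eq_sym qpiE -eqJ repr_qpiB.
have GE x : G (\pi_(Hquo2 u' v') x) = \pi_(Hquo2 u v) x.
  by apply/eqP; rewrite eq_sym qpiE eqJ repr_qpiB.
have Flin : linear F.
  move=> a; elim/quotW=> x; elim/quotW=> y.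
  by rewrite qpiM -qpiD !FE qpiM -qpiD.
pose FL := GRing.isLinear.Build _ _ _ _ F Flin.
pose phi : {linear Hquo2 u v -> Hquo2 u' v'} := HB.pack F FL.
exists phi.
  exists G; first by elim/quotW=> x; rewrite /= FE GE.
  by elim/quotW=> x; rewrite /= GE FE.
move=> n; elim/quotW=> x; rewrite /= FE; split=> [[a an /eqP xa]|[a an /eqP xa]].
  by exists a => //; apply/eqP; rewrite qpiE -eqJ -qpiE.
by exists a => //; apply/eqP; rewrite qpiE eqJ -qpiE.
Qed.

Lemma lideal2_basis_change (u v x y : Hhat k) (a b c d : k) :
  a * d - b * c != 0 -> u = a *: x + b *: y -> v = c *: x + d *: y ->
  lideal2 u v =i lideal2 x y.
Proof.
set D := _ - _ => D0 uE vE z.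
have sub (u1 v1 x1 y1 : Hhat k) : u1 \in lideal2 x1 y1 -> v1 \in lideal2 x1 y1 ->
    z \in lideal2 u1 v1 -> z \in lideal2 x1 y1.
  move=> uJ vJ /lideal2P[r [s ->]]; apply: rpredD; exact: lideal2Ml.
apply/idP/idP; apply: sub.
- by rewrite uE rpredD ?lideal2Z ?lideal2l ?lideal2r.
- by rewrite vE rpredD ?lideal2Z ?lideal2l ?lideal2r.
- have -> : x = D^-1 *: (d *: u - b *: v).
    rewrite -(scalerK D0 x); congr (_ *: _).
    by rewrite uE vE !scalerDr !scalerA opprD addrACA -!scalerBl
      [d * b]mulrC subrr scale0r addr0 [d * a]mulrC.
  by rewrite lideal2Z // rpredB ?lideal2Z ?lideal2l ?lideal2r.
- have -> : y = D^-1 *: (a *: v - c *: u).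
    rewrite -(scalerK D0 y); congr (_ *: _).
    by rewrite uE vE !scalerDr !scalerA opprD addrACA -!scalerBl
      [c * a]mulrC subrr scale0r add0r [c * b]mulrC.
  by rewrite lideal2Z // rpredB ?lideal2Z ?lideal2l ?lideal2r.
Qed.
End LineModules.

(** * Lines in projective 3-space *)

Section Lines.
Variable k : fieldType.
Local Notation gen := (hgen k).

Definition row4 (a b c d : k) : 'rV[k]_4 := \row_j [:: a; b; c; d]`_j.
Definition col4 (a b c d : k) : 'cV[k]_4 := \col_j [:: a; b; c; d]`_j.

Lemma ord4_forall (P : 'I_4 -> Prop) :
  P 0 -> P 1 -> P 2%:R -> P 3%:R -> forall i, P i.
Proof.
move=> P0 P1 P2 P3 [[|[|[|[|i]]]] lt_i] //.
- by rewrite (_ : Ordinal _ = 0) //; exact: val_inj.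
- by rewrite (_ : Ordinal _ = 1) //; exact: val_inj.
- by rewrite (_ : Ordinal _ = 2%:R) //; exact: val_inj.
- by rewrite (_ : Ordinal _ = 3%:R) //; exact: val_inj.
Qed.

Lemma sum4 (V : nmodType) (F : 'I_4 -> V) :
  \sum_i F i = F 0 + F 1 + F 2%:R + F 3%:R.
Proof.
rewrite !big_ord_recl big_ord0 addr0 !addrA.
by congr (_ + F _ + F _ + F _); exact: val_inj.
Qed.

Lemma row4_mul (x : 'rV[k]_4) (p : 'cV[k]_4) : x *m p = 0 <->
  x 0 0 * p 0 0 + x 0 1 * p 1 0 + x 0 2%:R * p 2%:R 0 + x 0 3%:R * p 3%:R 0 = 0.
Proof.
rewrite -(sum4 (fun j => x 0 j * p j 0)); split=> [/matrixP /(_ 0 0)|xp].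
  by rewrite !mxE.
by apply/matrixP => i j; rewrite !ord1 !mxE.
Qed.

Lemma hlin_row4 a b c d : hlin (row4 a b c d) =
  a *: gen 0 + b *: gen 1 + c *: gen 2%:R + d *: gen 3%:R.
Proof. by rewrite /hlin sum4 !mxE. Qed.

Lemma hlinD (x y : 'rV[k]_4) : hlin (x + y) = hlin x + hlin y.
Proof.
by rewrite /hlin -big_split; apply: eq_bigr => i _; rewrite mxE scalerDl.
Qed.

Lemma hlinZ (a : k) (x : 'rV[k]_4) : hlin (a *: x) = a *: hlin x.
Proof.
by rewrite /hlin scaler_sumr; apply: eq_bigr => i _; rewrite mxE scalerA.
Qed.

Lemma free2P (V : vectType k) (u v : V) : free [:: u; v] <->
  forall x y : k, x *: u + y *: v = 0 -> x = 0 /\ y = 0.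
Proof.
rewrite free_cons span_seq1 seq1_free; split=> [/andP[uv v0] x y xy|uv].
  have x0 : x = 0.
    apply/eqP; apply: contraNT uv => x0; apply/vlineP; exists (- (x^-1 * y)).
    apply: (scalerI x0); apply/eqP; rewrite scalerA mulrN mulrA divff // mul1r.
    by rewrite scaleNr -addr_eq0 xy.
  split=> //; move/eqP: xy; rewrite x0 scale0r add0r scaler_eq0 (negPf v0) orbF.
  by move/eqP.
apply/andP; split; apply/negP.
  case/vlineP=> y uE; have [] := uv 1 (- y).
    by rewrite uE scale1r scaleNr subrr.
  by move/eqP; rewrite oner_eq0.
move/eqP=> v0; have [] := uv 0 1; first by rewrite v0 scale0r scaler0 addr0.
by move=> _ /eqP; rewrite oner_eq0.
Qed.

Definition row_h lambda := row4 0 0 1 (- lambda).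
Definition row_ef alpha beta mu := row4 alpha beta 0 (- mu).

Lemma hlin_row_h lambda : hlin (row_h lambda) = gen 2%:R - lambda *: gen 3%:R.
Proof. by rewrite hlin_row4 !scale0r !add0r scale1r scaleNr. Qed.

Lemma hlin_row_ef alpha beta mu : hlin (row_ef alpha beta mu) =
  alpha *: gen 0 + beta *: gen 1 - mu *: gen 3%:R.
Proof. by rewrite hlin_row4 scale0r addr0 scaleNr. Qed.

(** On V(h, t) only the first two coordinates of p survive, so a form vanishing
    at p has its e and f coefficients proportional to (p_f, - p_e).  The
    coefficient of t is then determined by vanishing at r. *)
Lemma form_through_points (x : 'rV[k]_4) (p r : 'cV[k]_4) :
  p != 0 -> form_h k *m p = 0 -> form_t k *m p = 0 -> r 3%:R 0 != 0 ->
  x *m p = 0 -> x *m r = 0 ->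
  exists a, x = a *: row_ef (p 1 0) (- p 0 0)
      ((p 1 0 * r 0 0 - p 0 0 * r 1 0) / r 3%:R 0)
    + x 0 2%:R *: row_h (r 2%:R 0 / r 3%:R 0).
Proof.
move=> p0 /row4_mul hp /row4_mul tp r3 /row4_mul xp /row4_mul xr.
rewrite !mxE /= !mul0r !add0r ?mul1r ?addr0 in hp tp.
rewrite hp tp !mulr0 !addr0 in xp.
have [a xE]: exists a, x 0 0 = a * p 1 0 /\ x 0 1 = - a * p 0 0.
  have [p00|p00] := eqVneq (p 0 0) 0.
    have p10 : p 1 0 != 0.
      apply: contraNneq p0 => p10; apply/eqP/colP.
      by apply: ord4_forall; rewrite mxE.
    exists (x 0 0 / p 1 0); rewrite divfK // p00 mulr0; split=> //.
    move/eqP: xp; rewrite p00 mulr0 add0r mulf_eq0 (negPf p10) orbF.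
    by move/eqP.
  exists (- (x 0 1 / p 0 0)); rewrite opprK divfK //; split=> //.
  apply: (mulIf p00); rewrite mulNr mulNr mulrAC divfK //.
  by apply/eqP; rewrite -addr_eq0 xp.
case: xE => x0 x1; exists a; rewrite x0 x1 in xr.
have x3 : x 0 3%:R =
    - (a * p 1 0 * r 0 0 - a * p 0 0 * r 1 0 + x 0 2%:R * r 2%:R 0) / r 3%:R 0.
  apply: (mulIf r3); rewrite divfK //.
  by apply/eqP; rewrite -addr_eq0 -xr; apply/eqP; ring.
apply/rowP; apply: ord4_forall; rewrite !mxE /= ?x0 ?x1 ?x3; ring.
Qed.

(** The two forms [u], [v] and the two standard forms are related by a matrix
    which is invertible since [u], [v] are independent. *)
Lemma line_ideal (u v : 'rV[k]_4) (p r : 'cV[k]_4) :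
  free [:: u; v] -> zero_locus [:: u; v] p ->
  zero_locus [:: form_h k; form_t k] p -> zero_locus [:: u; v] r ->
  r 3%:R 0 != 0 ->
  lideal2 (hlin u) (hlin v) =i
  lideal2 (hlin (row_h (r 2%:R 0 / r 3%:R 0)))
    (hlin (row_ef (p 1 0) (- p 0 0)
       ((p 1 0 * r 0 0 - p 0 0 * r 1 0) / r 3%:R 0))).
Proof.
move=> /free2P uv [p0 uvp] [_ htp] [_ uvr] r3.
have mem2 (x y : 'rV[k]_4) : y \in [:: x; y] by rewrite !inE eqxx orbT.
have hp := htp _ (mem_head _ _); have tp := htp _ (mem2 _ _).
have [a uE] := form_through_points p0 hp tp r3
  (uvp _ (mem_head _ _)) (uvr _ (mem_head _ _)).
have [b vE] := form_through_points p0 hp tp r3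
  (uvp _ (mem2 _ _)) (uvr _ (mem2 _ _)).
move: (row_ef _ _ _) (row_h _) uE vE => W H uE vE.
set c := u 0 2%:R in uE; set d := v 0 2%:R in vE.
apply: (@lideal2_basis_change _ _ _ _ _ c a d b).
- apply/eqP => D0.
  have Dl (s t : k) : s * a + t * b = 0 -> s * c + t * d = 0 -> s = 0 /\ t = 0.
    move=> E1 E2; apply: uv; rewrite uE vE !scalerDr !scalerA addrACA -!scalerDl.
    by rewrite E1 E2 !scale0r addr0.
  have [d0 c0] : d = 0 /\ - c = 0.
    apply: Dl; last by ring.
    by rewrite -[RHS]oppr0 -D0; ring.
  have [b0 a0] : b = 0 /\ - a = 0.
    apply: Dl; first by ring.
    by rewrite -D0; ring.
  move/eqP: c0; move/eqP: a0; rewrite !oppr_eq0 => /eqP a0 /eqP c0.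
  have [] := uv 1 0; first by rewrite uE a0 c0 !scale0r addr0 scale1r addr0.
  by move/eqP; rewrite oner_eq0.
- rewrite uE hlinD !hlinZ; exact: addrC.
- rewrite vE hlinD !hlinZ; exact: addrC.
Qed.

(** Evaluation at the point r, rescaled to t = 1, of the linear form on
    projective 3-space given by an element of sl(1|1). *)
Definition point_functional (r : 'cV[k]_4) (X : 'M[k]_2) : k^o :=
  (X 0 1 * r 0 0 + X 1 0 * r 1 0 + X 0 0 * r 2%:R 0) / r 3%:R 0.

Lemma point_functional_is_linear r : linear (point_functional r).
Proof.
move=> a X Y; rewrite /point_functional !mxE /GRing.scale /=.
by rewrite mulrA -mulrDl; congr (_ / _); ring.
Qed.
HB.instance Definition _ r :=
  GRing.isLinear.Build k 'M[k]_2 k^o *:%R (point_functional r)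
    (point_functional_is_linear r).

Lemma point_functional_vsproj (V : {vspace 'M[k]_2}) (r : 'cV[k]_4) X :
  X \in V ->
  linfun (point_functional r \o @vsval _ _ V) (vsproj V X) = point_functional r X.
Proof. by move=> XV; rewrite lfunE /= vsprojK. Qed.
End Lines.

(** * Lines and modules L *)

Section Main.
Variable k : fieldType.

Lemma point_functional_h (r : 'cV[k]_4) :
  point_functional r (sl_h k) = r 2%:R 0 / r 3%:R 0.
Proof. by rewrite /point_functional !mxE /= !mul0r !add0r mul1r. Qed.

Lemma point_functional_ef (r : 'cV[k]_4) (a b : k) :
  point_functional r (a *: sl_e k + b *: sl_f k) =
  (a * r 0 0 + b * r 1 0) / r 3%:R 0.
Proof.
rewrite /point_functional !mxE /= !(mulr0, mulr1, addr0, add0r) mul0r.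
by rewrite addr0.
Qed.

Lemma L_hE (V : {vspace 'M[k]_2}) (phi : 'Hom(subvs_of V, k^o)) :
  L_h phi = hlin (@row_h k (phi (vsproj V (sl_h k)))).
Proof. by rewrite hlin_row_h. Qed.

Lemma L_efE (V : {vspace 'M[k]_2}) (phi : 'Hom(subvs_of V, k^o)) (a b : k) :
  L_ef phi a b = hlin (@row_ef k a b (phi (vsproj V (a *: sl_e k + b *: sl_f k)))).
Proof. by rewrite hlin_row_ef. Qed.

Lemma line_is_L (u v : 'rV[k]_4) :
  free [:: u; v] ->
  ~ locus_sub [:: u; v] [:: form_t k] ->
  locus_meet [:: u; v] [:: form_h k; form_t k] ->
  exists (V : {vspace 'M[k]_2}) (phi : 'Hom(subvs_of V, k^o)) (alpha beta : k),
    is_subalgebra_at V alpha beta /\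
    graded_iso (@line_quo_deg k u v) (@Lmod_deg k V phi alpha beta).
Proof.
move=> uv /existsNP[r /not_implyP[uvr tr]] [p [uvp htp]].
have r3 : r 3%:R 0 != 0.
  apply: contra_notN tr => /eqP r3; split; first exact: uvr.1.
  move=> x; rewrite inE => /eqP ->; apply/row4_mul.
  by rewrite !mxE /= !mul0r !add0r mul1r.
pose a := p 1 0; pose b := - p 0 0.
pose V := (<[sl_h k]> + <[a *: sl_e k + b *: sl_f k]>)%VS.
pose phi : 'Hom(subvs_of V, k^o) := linfun (point_functional r \o @vsval _ _ V).
exists V, phi, a, b; split.
  split=> //; apply: contraNneq htp.1 => -[a0 b0]; apply/eqP/colP.
  have [h0 t0] : form_h k *m p = 0 /\ form_t k *m p = 0.
    by split; apply: htp.2; rewrite !inE eqxx ?orbT.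
  move/row4_mul: h0; move/row4_mul: t0.
  rewrite !mxE /= !mul0r !add0r ?mul1r ?addr0 => p3 p2.
  apply: ord4_forall; rewrite mxE //.
  by apply/eqP; rewrite -oppr_eq0 -/b b0.
apply: graded_iso_lideal2 => z; rewrite (line_ideal uv uvp htp uvr r3).
rewrite L_hE L_efE !point_functional_vsproj ?point_functional_h ?point_functional_ef.
- by rewrite mulNr.
- by rewrite memvE addvSr.
- by rewrite memvE addvSl.
Qed.

Lemma L_is_line (V : {vspace 'M[k]_2}) (phi : 'Hom(subvs_of V, k^o))
    (alpha beta : k) :
  (alpha, beta) != (0, 0) ->
  exists u v : 'rV[k]_4,
    [/\ corresponds_to_line_module u v,
        ~ locus_sub [:: u; v] [:: form_t k],
        locus_meet [:: u; v] [:: form_h k; form_t k] &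
        graded_iso (@Lmod_deg k V phi alpha beta) (@line_quo_deg k u v)].
Proof.
move=> ab0; pose lambda : k := phi (vsproj V (sl_h k)).
pose mu : k := phi (vsproj V (alpha *: sl_e k + beta *: sl_f k)).
exists (row_h lambda), (row_ef alpha beta mu); split.
- split; last first.
    apply: Hquo2_line_moduleP ab0 _ _; [exact: hlin_row_h|exact: hlin_row_ef].
  apply/free2P => x y /rowP xy.
  have x0 : x = 0 by have := xy 2%:R; rewrite !mxE /= mulr1 mulr0 addr0.
  split=> //; apply/eqP; apply: contraNT ab0 => y0.
  have := xy 0; have := xy 1; rewrite !mxE /= x0 !mul0r !add0r.
  by move/eqP; rewrite mulf_eq0 (negPf y0) => /eqP -> /eqP;
    rewrite mulf_eq0 (negPf y0) => /eqP ->.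
- have [x [y xyE]] : exists x y, alpha * x + beta * y = mu.
    have [a0|a0] := eqVneq alpha 0.
      have b0 : beta != 0 by apply: contraNneq ab0 => ->; rewrite a0.
      by exists 0, (beta^-1 * mu); rewrite mulr0 add0r mulVKf.
    by exists (alpha^-1 * mu), 0; rewrite mulr0 addr0 mulVKf.
  move/(_ (col4 x y lambda 1)); case.
    split; first by apply/eqP => /colP/(_ 3%:R)/eqP; rewrite !mxE oner_eq0.
    move=> w; rewrite !inE => /orP[] /eqP ->; apply/row4_mul;
      rewrite !mxE /=; first by ring.
    by rewrite -xyE; ring.
  move=> _ /(_ _ (mem_head _ _)) /row4_mul /eqP.
  by rewrite !mxE /= !mul0r !add0r mulr1 oner_eq0.
- exists (col4 beta (- alpha) 0 0); split; split.
  1,3: by apply: contraNneq ab0 => /colP p0; have := p0 0; have /eqP := p0 1;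
    rewrite !mxE /= oppr_eq0 => /eqP -> ->.
  1,2: move=> w; rewrite !inE => /orP[] /eqP ->; apply/row4_mul;
    by rewrite !mxE /=; ring.
- by apply: graded_iso_lideal2 => z; rewrite L_hE L_efE.
Qed.
End Main.

Theorem theorem2p3 (k : closedFieldType) (char_k : 2%N \notin [pchar k]) :
  (* every line module of a line of the given kind is some L_(V, phi) ... *)
  (forall u v : 'rV[k]_4,
     corresponds_to_line_module u v ->
     ~ locus_sub [:: u; v] [:: form_t k] ->
     locus_meet [:: u; v] [:: form_h k; form_t k] ->
     exists (V : {vspace 'M[k]_2}) (phi : 'Hom(subvs_of V, k^o)) (alpha beta : k),
       [/\ is_subalgebra V, \dim V = 2%N, is_subalgebra_at V alpha beta &
           graded_iso (@line_quo_deg k u v) (@Lmod_deg k V phi alpha beta)])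
  /\
  (* ... and conversely *)
  (forall (V : {vspace 'M[k]_2}) (phi : 'Hom(subvs_of V, k^o)) (alpha beta : k),
     is_subalgebra V -> \dim V = 2%N -> is_subalgebra_at V alpha beta ->
     exists u v : 'rV[k]_4,
       [/\ corresponds_to_line_module u v,
           ~ locus_sub [:: u; v] [:: form_t k],
           locus_meet [:: u; v] [:: form_h k; form_t k] &
           graded_iso (@Lmod_deg k V phi alpha beta) (@line_quo_deg k u v)]).
Proof.
split=> [u v [uv _] ut uht|V phi alpha beta _ _ [ab0 _]]; last exact: L_is_line.
have [V [phi [alpha [beta [Vab iso]]]]] := line_is_L uv ut uht.
have [subV dimV] : is_subalgebra V /\ \dim V = 2%N.
  by apply/subalgebra_classification; exists alpha, beta.
by exists V, phi, alpha, beta.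
Qed.
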